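(* For integers $m\ge2$ and $t,n\ge0$ let $\mathsf{nww}(m,t,n)$ be the number of web worlds $W$ whose set of pegs (pegs incident to at least one edge) is contained in $\{1,\dots,m\}$, whose diagrams have exactly $t$ edges, and in which exactly $n$ distinct pairs of pegs are joined by at least one edge. Then, as formal power series, $$\sum_{m\ge2,\;t,n\ge0}\mathsf{nww}(m,t,n)\,u^m z^t y^n=\sum_{m\ge2}\Big(1+\frac{yz}{1-z}\Big)^{\binom m2}u^m.$$
   Context: A web diagram with $L$ edges is a set $D=\{(x_j,y_j,a_j,b_j):1\le j\le L\}$ of distinct 4-tuples of positive integers with $x_j<y_j$ (edge from peg $x_j$ at height $a_j$ to peg $y_j$ at height $b_j$) such that for each peg $i$ the heights of the endpoints on peg $i$ are exactly $1,\dots,p_i$, where $p_i$ is the number of edge endpoints on peg $i$; the empty diagram ($L=0$) is allowed. The web world $W(D)$ is the set of all diagrams obtained from $D$ by permuting the heights independently on each peg. All diagrams of a web world have the same number of edges and the same numbers $a_{ij}$ ($i<j$) of edges joining pegs $i$ and $j$, and a web world is determined by these numbers $(a_{ij})$; every choice of nonnegative integers $a_{ij}$ arises. *)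

(* Defs.v *)
From HB Require Import structures.
From mathcomp Require Import all_boot all_order all_algebra.
From mathcomp Require Import finmap.
From mathcomp Require Import boolp classical_sets functions cardinality fsbigop.

Set Implicit Arguments.
Unset Strict Implicit.
Unset Printing Implicit Defensive.

Import GRing.Theory.

Local Open Scope classical_set_scope.
Local Open Scope fset_scope.

(** * Web diagrams and web worlds *)

(* The edge (x, y, a, b) runs from peg x at height a to peg y at height b. *)
Notation edge := (nat * nat * nat * nat)%type.

Definition src (e : edge) : nat := e.1.1.1.
Definition tgt (e : edge) : nat := e.1.1.2.
Definition src_height (e : edge) : nat := e.1.2.
Definition tgt_height (e : edge) : nat := e.2.

(* Heights of the endpoints on peg i, listed with multiplicity; the length of
   the list is thus the number p_i of endpoints on peg i. *)
Definition endpoint_heights (D : {fset edge}) (i : nat) : seq nat :=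
  [seq src_height e | e <- enum_fset D & src e == i] ++
  [seq tgt_height e | e <- enum_fset D & tgt e == i].

Definition nb_endpoints (D : {fset edge}) (i : nat) : nat :=
  size (endpoint_heights D i).

Definition web_diagram (D : {fset edge}) : Prop :=
  (forall e, e \in D ->
     [/\ 0 < src e, src e < tgt e, 0 < src_height e & 0 < tgt_height e]) /\
  (forall i h,
     (h \in endpoint_heights D i) = (1 <= h <= nb_endpoints D i)).

Definition pegs (D : {fset edge}) : {fset nat} :=
  [fset src e | e in D] `|` [fset tgt e | e in D].

(* Since src e < tgt e, each joined pair of pegs occurs once, in increasing
   order. *)
Definition joined_pairs (D : {fset edge}) : {fset nat * nat} :=
  [fset (src e, tgt e) | e in D].

Definition permute_heights (s : nat -> nat -> nat) (D : {fset edge}) :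
    {fset edge} :=
  [fset ((src e, tgt e, s (src e) (src_height e),
         s (tgt e) (tgt_height e)) : edge) | e in D].

(* s i is the permutation of the heights 1, ..., p_i applied on peg i. *)
Definition web_world_of (D : {fset edge}) : set {fset edge} :=
  [set D' | exists2 s : nat -> nat -> nat,
     forall i, set_bij [set h | 1 <= h <= nb_endpoints D i]
                       [set h | 1 <= h <= nb_endpoints D i] (s i)
     & D' = permute_heights s D].

Definition web_world (W : set {fset edge}) : Prop :=
  exists2 D, web_diagram D & W = web_world_of D.

Definition web_worlds (m t n : nat) : set (set {fset edge}) :=
  [set W | web_world W /\
     forall D, W D ->
       [/\ forall i, i \in pegs D -> 1 <= i <= m,
           #|` D| = t &
           #|` joined_pairs D| = n]].

Definition nww (m t n : nat) : nat := #|` fset_set (web_worlds m t n)|.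

(* [fset_set A] is empty when A is infinite; the sets counted here are finite. *)
Lemma web_worlds_finite m t n : finite_set (web_worlds m t n).
Proof.
pose O : finType := 'I_(m + t.*2).+1.
pose f (o : O * O * O * O) : edge :=
  (val o.1.1.1, val o.1.1.2, val o.1.2, val o.2).
pose s : seq edge := map f (enum predT).
pose E : {fset edge} := [fset e in s].
apply: (@sub_finite_set _ _ (web_world_of @` [set` fpowerset E])); last first.
  exact/finite_image/finite_fset.
move=> W [[D [De Dh] ->] H]; exists D => //=.
have WD : web_world_of D D.
  exists (fun _ => id); first by move=> i; split => // h ? ; exists h.
  apply/fsetP => -[[[x y] a] b]; apply/idP/imfsetP => /=.
    by move=> eD; exists (x, y, a, b).
  by move=> [[[[x' y'] a'] b'] eD ->].
have [Hp Ht _] := H _ WD.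
have nbE i : nb_endpoints D i <= t.*2.
  rewrite /nb_endpoints /endpoint_heights size_cat !size_map -addnn -Ht.
  by rewrite leq_add // size_filter count_size.
rewrite fpowersetE; apply/fsubsetP => -[[[x y] a] b] eD.
have xD : x \in pegs D.
  by rewrite in_fsetU; apply/orP; left; apply/imfsetP; exists (x, y, a, b).
have yD : y \in pegs D.
  by rewrite in_fsetU; apply/orP; right; apply/imfsetP; exists (x, y, a, b).
have aD : a \in endpoint_heights D x.
  rewrite mem_cat; apply/orP; left; apply/mapP; exists (x, y, a, b) => //.
  by rewrite mem_filter eqxx.
have bD : b \in endpoint_heights D y.
  rewrite mem_cat; apply/orP; right; apply/mapP; exists (x, y, a, b) => //.
  by rewrite mem_filter eqxx.
move: (Hp _ xD) (Hp _ yD) => /andP[_ xm] /andP[_ ym].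
move: aD bD; rewrite !Dh => /andP[_ ax] /andP[_ bx].
have lm k : k <= m -> k < (m + t.*2).+1.
  by move=> /leq_trans; apply; apply: leq_addr.
have lt i k : k <= nb_endpoints D i -> k < (m + t.*2).+1.
  by move=> kn; rewrite ltnS (leq_trans kn) // (leq_trans (nbE i)) ?leq_addl.
rewrite in_fset; apply/mapP.
exists (Ordinal (lm _ xm), Ordinal (lm _ ym),
  Ordinal (lt _ _ ax), Ordinal (lt _ _ bx)) => //.
by rewrite mem_enum.
Qed.

Local Open Scope ring_scope.

(** * Formal power series in the three variables u, z, y *)

(* [coef f i j k] is the coefficient of u^i z^j y^k. *)
Record fps (R : Type) : Type := Fps { coef : nat -> nat -> nat -> R }.

Lemma fpsP (R : Type) (f g : fps R) :
  (forall i j k, coef f i j k = coef g i j k) -> f = g.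
Proof.
case: f g => f [g] /= fg; congr Fps.
by apply: funext => i; apply: funext => j; apply: funext => k.
Qed.

HB.instance Definition _ (R : Type) := gen_eqMixin (fps R).
HB.instance Definition _ (R : Type) := gen_choiceMixin (fps R).

Definition fps_zero (R : zmodType) : fps R := Fps (fun _ _ _ => 0).
Definition fps_opp (R : zmodType) (f : fps R) : fps R :=
  Fps (fun i j k => - coef f i j k).
Definition fps_add (R : zmodType) (f g : fps R) : fps R :=
  Fps (fun i j k => coef f i j k + coef g i j k).

Lemma fps_addA (R : zmodType) : associative (@fps_add R).
Proof. by move=> f g h; apply: fpsP => i j k /=; rewrite addrA. Qed.
Lemma fps_addC (R : zmodType) : commutative (@fps_add R).
Proof. by move=> f g; apply: fpsP => i j k /=; rewrite addrC. Qed.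
Lemma fps_add0 (R : zmodType) : left_id (fps_zero R) (@fps_add R).
Proof. by move=> f; apply: fpsP => i j k /=; rewrite add0r. Qed.
Lemma fps_addN (R : zmodType) :
  left_inverse (fps_zero R) (@fps_opp R) (@fps_add R).
Proof. by move=> f; apply: fpsP => i j k /=; rewrite addNr. Qed.

HB.instance Definition _ (R : zmodType) := GRing.isZmodule.Build (fps R)
  (@fps_addA R) (@fps_addC R) (@fps_add0 R) (@fps_addN R).

(* The monomial u^a z^b y^c. *)
Definition monom (R : nzRingType) (a b c : nat) : fps R :=
  Fps (fun i j k => [&& i == a, j == b & k == c]%:R).

Definition fps_mul (R : nzRingType) (f g : fps R) : fps R :=
  Fps (fun i j k =>
    \sum_(i1 < i.+1) \sum_(j1 < j.+1) \sum_(k1 < k.+1)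
       coef f i1 j1 k1 * coef g (i - i1) (j - j1) (k - k1)).

(* The ring axioms are transported from trivariate polynomials having the same
   coefficients up to a given degree. *)
Definition agree (R : nzRingType) (N : nat)
    (P : {poly {poly {poly R}}}) (f : fps R) : Prop :=
  forall i j k, (i < N)%N -> (j < N)%N -> (k < N)%N ->
    P`_i`_j`_k = coef f i j k.

Definition trunc (R : nzRingType) (N : nat) (f : fps R) :
    {poly {poly {poly R}}} :=
  \poly_(i < N) \poly_(j < N) \poly_(k < N) coef f i j k.

Lemma agree_trunc (R : nzRingType) N (f : fps R) : agree N (trunc N f) f.
Proof. by move=> i j k iN jN kN; rewrite !(coef_poly, iN, jN, kN). Qed.

Lemma agreeM (R : nzRingType) N P Q (f g : fps R) :
  agree N P f -> agree N Q g -> agree N (P * Q) (fps_mul f g).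
Proof.
move=> Pf Qg i j k iN jN kN /=; rewrite coefM !coef_sum.
apply: eq_bigr => i1 _; rewrite coefM coef_sum.
apply: eq_bigr => j1 _; rewrite coefM.
apply: eq_bigr => k1 _.
have lt (a b : nat) : (b < N)%N -> (b - a < N)%N.
  by move=> bN; rewrite (leq_ltn_trans _ bN) // leq_subr.
by rewrite Pf ?Qg ?lt //; apply: leq_trans (ltn_ord _) _.
Qed.

Lemma agree_eq (R : nzRingType) (f g : fps R) :
  (forall N, exists2 P, agree N P f & agree N P g) -> f = g.
Proof.
move=> fg; apply: fpsP => i j k.
have [P Pf Pg] := fg (maxn i (maxn j k)).+1.
by rewrite -Pf ?Pg // ltnS ?leq_max leqnn ?orbT.
Qed.

Lemma fps_mulA (R : comNzRingType) : associative (@fps_mul R).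
Proof.
move=> f g h; apply: agree_eq => N.
have [Hf Hg Hh] :=
  And3 (@agree_trunc _ N f) (@agree_trunc _ N g) (@agree_trunc _ N h).
exists (trunc N f * (trunc N g * trunc N h)); first exact/agreeM/agreeM.
by rewrite mulrA; apply/agreeM => //; apply/agreeM.
Qed.

Lemma fps_mulC (R : comNzRingType) : commutative (@fps_mul R).
Proof.
move=> f g; apply: agree_eq => N.
have [Hf Hg] := conj (@agree_trunc _ N f) (@agree_trunc _ N g).
exists (trunc N f * trunc N g); first exact/agreeM.
by rewrite mulrC; apply/agreeM.
Qed.

Lemma sum_delta (R : nzRingType) n a (F : nat -> R) :
  \sum_(x < n.+1) (val x == a)%:R * F x = (a <= n)%:R * F a.
Proof.
case: (leqP a n) => an.
  rewrite (bigD1 (Ordinal (an : a < n.+1)%N)) //= eqxx big1 ?addr0 // => x.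
  by rewrite -val_eqE /= => /negbTE ->; rewrite mul0r.
rewrite mul0r big1 // => x _; case: eqP => [xa|_]; last by rewrite mul0r.
by move: (ltn_ord x); rewrite ltnS xa leqNgt an.
Qed.

Lemma coef_monomM (R : nzRingType) a b c (f : fps R) i j k :
  coef (fps_mul (monom R a b c) f) i j k =
  [&& a <= i, b <= j & c <= k]%N%:R * coef f (i - a) (j - b) (k - c).
Proof.
rewrite /=.
transitivity (\sum_(i1 < i.+1) (val i1 == a)%:R *
  (\sum_(j1 < j.+1) (val j1 == b)%:R * (\sum_(k1 < k.+1) (val k1 == c)%:R *
    coef f (i - i1) (j - j1) (k - k1)))).
  apply: eq_bigr => i1 _; rewrite mulr_sumr; apply: eq_bigr => j1 _.
  rewrite !mulr_sumr; apply: eq_bigr => k1 _.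
  by rewrite -!mulnb !natrM !mulrA.
rewrite (@sum_delta _ i a (fun x => \sum_(j1 < j.+1) (val j1 == b)%:R *
  (\sum_(k1 < k.+1) (val k1 == c)%:R * coef f (i - x) (j - j1) (k - k1)))).
rewrite (@sum_delta _ j b (fun x =>
  \sum_(k1 < k.+1) (val k1 == c)%:R * coef f (i - a) (j - x) (k - k1))).
rewrite (@sum_delta _ k c (fun x => coef f (i - a) (j - b) (k - x))).
by rewrite -!mulnb !natrM !mulrA.
Qed.

Lemma fps_mul1 (R : comNzRingType) : left_id (monom R 0 0 0) (@fps_mul R).
Proof.
by move=> f; apply: fpsP => i j k; rewrite coef_monomM !subn0 mul1r.
Qed.

Lemma fps_mulDl (R : comNzRingType) :
  left_distributive (@fps_mul R) (@fps_add R).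
Proof.
move=> f g h; apply: fpsP => i j k /=; rewrite -big_split.
apply: eq_bigr => i1 _; rewrite -big_split; apply: eq_bigr => j1 _.
by rewrite -big_split; apply: eq_bigr => k1 _; rewrite /= mulrDl.
Qed.

Lemma fps_1_neq0 (R : nzRingType) : monom R 0 0 0 != 0.
Proof.
apply/eqP => /(congr1 (fun f : fps R => coef f 0 0 0)) /= /eqP.
by rewrite oner_eq0.
Qed.

HB.instance Definition _ (R : comNzRingType) :=
  GRing.Zmodule_isComNzRing.Build (fps R)
    (@fps_mulA R) (@fps_mulC R) (@fps_mul1 R) (@fps_mulDl R) (@fps_1_neq0 R).

Definition fps_unit (R : comNzRingType) : {pred fps R} :=
  fun f => `[< exists g : fps R, g * f = 1 >].

Definition fps_inv (R : comNzRingType) (f : fps R) : fps R :=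
  match pselect (exists g : fps R, g * f = 1) with
  | left h => projT1 (cid h)
  | right _ => f
  end.

Lemma fps_mulVx (R : comNzRingType) :
  {in @fps_unit R, left_inverse 1 (@fps_inv R) *%R}.
Proof.
move=> f /asboolP Uf; rewrite /fps_inv; case: pselect => // h.
by case: cid.
Qed.

Lemma fps_unitPl (R : comNzRingType) (f g : fps R) :
  g * f = 1 -> fps_unit f.
Proof. by move=> gf; apply/asboolP; exists g. Qed.

Lemma fps_inv_out (R : comNzRingType) :
  {in [predC @fps_unit R], @fps_inv R =1 id}.
Proof.
by move=> f /asboolPn Uf; rewrite /fps_inv; case: pselect.
Qed.

HB.instance Definition _ (R : comNzRingType) :=
  GRing.ComNzRing_hasMulInverse.Build (fps R)
    (@fps_mulVx R) (@fps_unitPl R) (@fps_inv_out R).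

Definition varu : fps int := monom int 1 0 0.
Definition varz : fps int := monom int 0 1 0.
Definition vary : fps int := monom int 0 0 1.

(* The sum of a possibly infinite family, computed coefficientwise; it is
   meaningful when the family is summable, i.e. when only finitely many members
   contribute to each coefficient. *)
Definition fps_summable (R : nmodType) (I : choiceType) (A : set I)
    (F : I -> fps R) : Prop :=
  forall i j k, finite_set [set x | A x /\ coef (F x) i j k != 0].

Definition fps_sum (R : nmodType) (I : choiceType) (A : set I)
    (F : I -> fps R) : fps R :=
  Fps (fun i j k => \sum_(x \in A) coef (F x) i j k).

Lemma monomM (R : comNzRingType) a b c a' b' c' :
  monom R a b c * monom R a' b' c' = monom R (a + a') (b + b') (c + c').
Proof.
apply: fpsP => i j k; rewrite [LHS]coef_monomM /= -natrM mulnb.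
have E (x y z : nat) : (z == x + y)%N = (x <= z)%N && (z - x == y)%N.
  case: leqP => xz /=; first by rewrite -[in LHS](subnKC xz) eqn_add2l.
  by apply: contraTF xz => /eqP ->; rewrite -leqNgt leq_addr.
congr _%:R; congr nat_of_bool; rewrite !E.
by case: (a <= i)%N; case: (b <= j)%N; case: (c <= k)%N; rewrite /= ?andbF.
Qed.

Lemma monomX (R : comNzRingType) a b c n :
  monom R a b c ^+ n = monom R (a * n) (b * n) (c * n).
Proof.
elim: n => [|n IHn]; first by rewrite expr0 !muln0.
by rewrite exprS IHn monomM !mulnS.
Qed.

(* So that the division by 1 - z below is a genuine one. *)
Lemma unit_1Bvarz : 1 - varz \is a GRing.unit.
Proof.
apply/asboolP.
exists (Fps (fun i j k => ((i == 0) && (k == 0))%N%:R) : fps int).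
rewrite mulrC mulrBl mul1r; apply: fpsP => i j k.
rewrite [LHS]/(_ - coef (fps_mul (monom int 0 1 0) _) i j k) coef_monomM /=.
rewrite !subn0 -natrM mulnb.
by case: i j k => [|i] [|j] [|k].
Qed.

Lemma coef_natM (R : comNzRingType) n (f : fps R) i j k :
  coef (n%:R * f) i j k = n%:R * coef f i j k.
Proof.
elim: n => [|n IHn]; first by rewrite !mul0r.
by rewrite -!natr1 !mulrDl !mul1r -IHn.
Qed.

Lemma nww_summable (A : set (nat * nat * nat)) :
  fps_summable A (fun '(m, t, n) =>
    (nww m t n)%:R * varu ^+ m * varz ^+ t * vary ^+ n).
Proof.
move=> i j k; apply: (@sub_finite_set _ _ [set (i, j, k)]); last first.
  exact: finite_set1.
move=> [[m t] n] [_]; rewrite /varu /varz /vary !monomX.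
rewrite -!mulrA !monomM !(muln0, muln1, mul0n, mul1n, addn0, add0n).
rewrite coef_natM /=.
by case: and3P => [[/eqP -> /eqP -> /eqP ->] //|_]; rewrite mulr0 eqxx.
Qed.

Lemma powu_summable (A : set nat) (F : nat -> fps int) :
  fps_summable A (fun m => F m * varu ^+ m).
Proof.
move=> i j k; apply: (@sub_finite_set _ _ `I_i.+1); last exact: finite_II.
move=> m [_]; rewrite mulrC /varu monomX.
rewrite [X in X != _]coef_monomM mul1n /= ltnS.
by case: (m <= i)%N => //; rewrite mul0r eqxx.
Qed.

(* Main.v *)
Require Import Defs.
From mathcomp Require Import all_boot all_order all_algebra.
From mathcomp Require Import finmap.
From mathcomp Require Import boolp classical_sets functions cardinality fsbigop.

(** A web world is determined by how many edges join each pair of pegs: a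
    diagram can be carried to any other one with the same multiplicities by
    matching the edges pair by pair, and the matching moves the heights on each
    peg by a permutation.  Conversely any multiplicities are realised, by adding
    edges one at a time on top of their pegs.  Hence nww(m, t, n) is the number
    of sequences of 'C(m, 2) naturals with sum t and n nonzero entries, whose
    generating function is the 'C(m, 2)-th power of 1 + yz + yz^2 + ... *)

Set Implicit Arguments.
Unset Strict Implicit.
Unset Printing Implicit Defensive.

Import GRing.Theory.
Local Open Scope classical_set_scope.

(** * Matching lists entry by entry *)

(** The index permutation that carries [map f t] to [map f s] can be applied to [t] itself. *)
Lemma perm_map_lift (T U : eqType) (f : T -> U) (s t : seq T) :
  perm_eq (map f s) (map f t) ->
  exists2 t', perm_eq t' t & map f s = map f t'.
Proof.
case: t => [|x0 t] fst.
  by exists [::] => //; rewrite (perm_nilP fst).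
move: (fst) => /(perm_iotaP (f x0))[Is]; rewrite size_map => Is_iota ->.
exists (map (nth x0 (x0 :: t)) Is); first by apply/(perm_iotaP x0); exists Is.
rewrite -map_comp; apply/eq_in_map => i.
rewrite (perm_mem Is_iota) mem_iota add0n => /andP[_ it].
exact: (nth_map x0 (f x0)).
Qed.

Lemma set_bij_nth_index (T : eqType) (x0 : T) (s t : seq T) :
  uniq s -> uniq t -> size s = size t ->
  set_bij [set` s] [set` t] (fun x => nth x0 t (index x s)).
Proof.
move=> Us Ut st; split => [x /= xs|x y|y /= yt].
- by rewrite mem_nth // -st index_mem.
- rewrite !inE /= => xs ys /eqP.
  by rewrite nth_uniq -?st ?index_mem // => /eqP; exact: index_inj.
- exists (nth x0 s (index y t)); first by rewrite mem_nth // st index_mem.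
  by rewrite index_uniq ?nth_index // st index_mem.
Qed.

(** * Links and heights of a diagram *)

Definition link (e : edge) : nat * nat := (src e, tgt e).

Definition links (D : {fset edge}) : seq (nat * nat) := map link D.

(** The list has the same members as the interval and the same length, so no height is repeated. *)
Lemma endpoint_heights_perm D i :
  web_diagram D ->
  perm_eq (endpoint_heights D i) (iota 1 (nb_endpoints D i)).
Proof.
move=> [_ Dh].
have E : iota 1 (nb_endpoints D i) =i endpoint_heights D i.
  by move=> h; rewrite Dh mem_iota add1n ltnS.
rewrite perm_sym uniq_perm ?iota_uniq //.
by rewrite (uniq_size_uniq (iota_uniq 1 _) E) size_iota.
Qed.

Lemma src_height_endpoint (D : {fset edge}) e :
  e \in D -> src_height e \in endpoint_heights D (src e).
Proof.
by move=> eD; rewrite mem_cat map_f // mem_filter eqxx.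
Qed.

Lemma tgt_height_endpoint (D : {fset edge}) e :
  e \in D -> tgt_height e \in endpoint_heights D (tgt e).
Proof.
by move=> eD; rewrite mem_cat [X in _ || X]map_f ?orbT // mem_filter eqxx.
Qed.

(** * A web world is the set of diagrams with a given multiset of links *)

Section Permute.

Variables (D : {fset edge}) (s : nat -> nat -> nat).
Hypothesis D_web : web_diagram D.
Hypothesis s_bij : forall i,
  set_bij [set h | 1 <= h <= nb_endpoints D i]
          [set h | 1 <= h <= nb_endpoints D i] (s i).

Let permute_edge (e : edge) : edge :=
  (src e, tgt e, s (src e) (src_height e), s (tgt e) (tgt_height e)).

Let s_inj i : {in endpoint_heights D i &, injective (s i)}.
Proof.
have [_ Dh] := D_web; have [_ inj _] := s_bij i.
by move=> h h'; rewrite !Dh => hp hp'; apply: inj; rewrite inE.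
Qed.

Lemma enum_permute_heights :
  perm_eq (permute_heights s D) (map permute_edge D).
Proof.
(* No two edges merge: links are kept, and each [s i] is injective on the heights that occur on peg
   [i]. *)
apply: enum_imfset => -[[[x y] a] b] [[[x' y'] a'] b'] eD eD' [ex ey].
rewrite /src /tgt /= in ex ey; rewrite -{}ex -{}ey in eD' * => sa sb.
congr (_, _, _, _).
  exact: s_inj (src_height_endpoint eD) (src_height_endpoint eD') sa.
exact: s_inj (tgt_height_endpoint eD) (tgt_height_endpoint eD') sb.
Qed.

Lemma links_permute_heights : perm_eq (links (permute_heights s D)) (links D).
Proof.
rewrite /links (permPl (perm_map _ enum_permute_heights)) -map_comp.
exact: perm_refl.
Qed.

Lemma endpoint_heights_permute i :
  perm_eq (endpoint_heights (permute_heights s D) i)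
          (map (s i) (endpoint_heights D i)).
Proof.
rewrite map_cat perm_cat //.
  rewrite (permPl (perm_map _ (perm_filter _ enum_permute_heights))).
  rewrite filter_map -!map_comp.
  suff /eq_in_map -> : {in [seq e <- D | src e == i],
    src_height \o permute_edge =1 s i \o src_height} by exact: perm_refl.
  by move=> e; rewrite mem_filter => /andP[/eqP <- _].
rewrite (permPl (perm_map _ (perm_filter _ enum_permute_heights))).
rewrite filter_map -!map_comp.
suff /eq_in_map -> : {in [seq e <- D | tgt e == i],
  tgt_height \o permute_edge =1 s i \o tgt_height} by exact: perm_refl.
by move=> e; rewrite mem_filter => /andP[/eqP <- _].
Qed.

Lemma web_diagram_permute : web_diagram (permute_heights s D).
Proof.
have [De Dh] := D_web.
have mapE i h : (h \in map (s i) (endpoint_heights D i)) =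
                (1 <= h <= nb_endpoints D i).
  have [sfun _ ssurj] := s_bij i.
  apply/mapP/idP => [[h' h'D ->]|hp]; first by apply: sfun; rewrite /= -Dh.
  by have [h' h'p <-] := ssurj _ hp; exists h' => //; rewrite Dh.
split=> [e /imfsetP[e' /= e'D ->]|i h].
  have [? ? _ _] := De _ e'D; split => //=.
    have : s (src e') (src_height e') \in
           map (s (src e')) (endpoint_heights D (src e')).
      by rewrite map_f // src_height_endpoint.
    by rewrite mapE => /andP[].
  have : s (tgt e') (tgt_height e') \in
         map (s (tgt e')) (endpoint_heights D (tgt e')).
    by rewrite map_f // tgt_height_endpoint.
  by rewrite mapE => /andP[].
rewrite (perm_mem (endpoint_heights_permute i)) mapE.
rewrite [in RHS]/nb_endpoints (perm_size (endpoint_heights_permute i)).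
by rewrite size_map.
Qed.

End Permute.

(* The same heights as in [endpoint_heights], but in the order of the edges, so
   that two lists of edges with equal links give lists that match entrywise. *)
Definition heights_at (i : nat) (l : seq edge) : seq nat :=
  [seq if src e == i then src_height e else tgt_height e
     | e <- l & (src e == i) || (tgt e == i)].

(** As the source lies strictly before the target, an edge meets peg [i] at most once, so the [if]
    picks its only endpoint there. *)
Lemma endpoint_heights_at (l : seq edge) i :
  {in l, forall e, src e < tgt e} ->
  perm_eq ([seq src_height e | e <- l & src e == i] ++
           [seq tgt_height e | e <- l & tgt e == i]) (heights_at i l).
Proof.
rewrite /heights_at; elim: l => //= e l IHl lt.
have /IHl{}IHl : {in l, forall e, src e < tgt e}.
  by move=> e' e'l; apply: lt; rewrite inE e'l orbT.
have lt_e := lt e (mem_head _ _); case sE: (src e == i) => /=.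
  have -> : (tgt e == i) = false by rewrite -(eqP sE) gtn_eqF.
  by rewrite sE perm_cons.
case: (tgt e == i) => //=.
by rewrite sE -cat1s perm_catCA perm_cons.
Qed.

(** Equal links make the filter keep the same positions in both lists, so the two height lists are
    aligned; distinctness of the heights makes [index] return the position coming from edge [k]. *)
Lemma nth_heights_at (e0 : edge) (l l' : seq edge) i k :
  map link l = map link l' -> uniq (heights_at i l) -> k < size l ->
  (src (nth e0 l k) == i) || (tgt (nth e0 l k) == i) ->
  let ht e := if src e == i then src_height e else tgt_height e in
  nth 0 (heights_at i l') (index (ht (nth e0 l k)) (heights_at i l)) =
  ht (nth e0 l' k).
Proof.
move=> ll' Ul kl inc ht; rewrite /heights_at.
elim: l l' k ll' Ul kl inc => // e l IHl [//|e' l'] k [es et ll'].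
rewrite /heights_at /= -es -et; case: ifP => inc_e; last first.
  by case: k => [|k] //=; [rewrite inc_e|rewrite ltnS => *; exact: IHl].
rewrite map_cons cons_uniq => /andP[eNl Ul].
case: k => [|k]; first by rewrite /= eqxx /ht /= -es.
rewrite /= ltnS => kl inc; rewrite [X in nth _ _ X]ifN /=; first exact: IHl.
apply: contra eNl => /eqP ->; apply: map_f.
by rewrite mem_filter inc mem_nth.
Qed.

Lemma web_world_ofE D : web_diagram D ->
  web_world_of D = [set D' | web_diagram D' /\ perm_eq (links D') (links D)].
Proof.
move=> Dw; apply/seteqP; split=> [_ [s s_bij ->]|D' [D'w D'D]].
  by split; [exact: web_diagram_permute|exact: links_permute_heights].
have [De _] := Dw; have [De' _] := D'w.
have [l' l'D' ll'] : exists2 l', perm_eq l' D' & map link D = map link l'.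
  by apply: perm_map_lift; rewrite perm_sym.
have lt_l' : {in l', forall e, src e < tgt e}.
  by move=> e; rewrite (perm_mem l'D') => /De'[].
have HD i : perm_eq (heights_at i D) (iota 1 (nb_endpoints D i)).
  rewrite -(permPr (endpoint_heights_perm i Dw)) perm_sym.
  by apply: endpoint_heights_at => e /De[].
have HD' i : perm_eq (heights_at i l') (iota 1 (nb_endpoints D' i)).
  rewrite -(permPr (endpoint_heights_perm i D'w)) perm_sym.
  rewrite -(permPr (endpoint_heights_at i lt_l')).
  by rewrite perm_cat // perm_map // perm_filter // perm_sym.
(* The number of endpoints on a peg depends on the links alone, so both diagrams use the same
   interval of heights there. *)
have size_links (i : nat) (l : seq edge) : size (heights_at i l) =
    count (fun p => (p.1 == i) || (p.2 == i)) (map link l).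
  by rewrite size_map size_filter count_map.
have HDl' i : size (heights_at i D) = size (heights_at i l').
  by rewrite !size_links ll'.
have nb i : nb_endpoints D' i = nb_endpoints D i.
  rewrite -(size_iota 1 (nb_endpoints D' i)) -(perm_size (HD' i)) -HDl'.
  by rewrite (perm_size (HD i)) size_iota.
(* The k-th edge of D is sent to the k-th edge of l'. *)
pose s i h := nth 0 (heights_at i l') (index h (heights_at i D)).
have setE i (t : seq nat) : perm_eq t (iota 1 (nb_endpoints D i)) ->
    [set` t] = [set h | 1 <= h <= nb_endpoints D i].
  move=> tE; apply/seteqP.
  by split=> h; rewrite /= (perm_mem tE) mem_iota add1n ltnS.
exists s => [i|].
  have HD'i := HD' i; rewrite nb in HD'i.
  rewrite -{1}(setE _ _ (HD i)) -(setE _ _ HD'i).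
  apply: set_bij_nth_index => //.
    by rewrite (perm_uniq (HD i)) iota_uniq.
  by rewrite (perm_uniq HD'i) iota_uniq.
have mapD : [seq ((src e, tgt e, s (src e) (src_height e),
         s (tgt e) (tgt_height e)) : edge) | e <- D] = l'.
  have sz : size D = size l' by rewrite -(size_map link) ll' size_map.
  pose e0 : edge := (0, 0, 0, 0).
  apply: (@eq_from_nth _ e0); rewrite size_map // => k kD.
  rewrite (nth_map e0) //; have kl' : k < size l' by rewrite -sz.
  have U i : uniq (heights_at i D) by rewrite (perm_uniq (HD i)) iota_uniq.
  (* The alignment is used at both ends of edge [k]; at its target peg the [if] takes the second
     branch because source and target differ. *)
  have := @nth_heights_at e0 D l' (src (nth e0 D k)) k ll' (U _) kD.
  have := @nth_heights_at e0 D l' (tgt (nth e0 D k)) k ll' (U _) kD.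
  rewrite /= !eqxx orbT => /(_ isT) tk /(_ isT) sk.
  have [_ lt _ _] := De _ (mem_nth e0 kD).
  have : nth (link e0) (map link D) k = nth (link e0) (map link l') k.
    by rewrite ll'.
  rewrite !(nth_map e0) // => -[ks kt].
  move: sk tk; rewrite -ks eqxx (ltn_eqF lt) /s => -> ->; rewrite ks kt.
  by case: (nth e0 l' k) => [[[x y] a] b].
apply/fsetP => e; rewrite -[e \in D'](perm_mem l'D') -mapD.
by apply/mapP/imfsetP => -[e' /= e'D ->]; exists e'.
Qed.

(** * Realising any multiset of links *)

Lemma web_diagram_add D x y : web_diagram D -> 0 < x < y ->
  exists2 D', web_diagram D' & perm_eq (links D') ((x, y) :: links D).
Proof.
move=> [De Dh] /andP[x0 xy].
(* The new edge takes the first free height on each of its two pegs. *)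
pose e : edge := (x, y, (nb_endpoints D x).+1, (nb_endpoints D y).+1).
have eND : e \notin D.
  by apply/negP => /src_height_endpoint; rewrite Dh ltnn andbF.
have DE : perm_eq (e |` D)%fset (e :: D).
  apply: uniq_perm => [||e']; rewrite ?fset_uniq //= ?eND ?fset_uniq //.
  by rewrite !inE.
exists (e |` D)%fset; last exact: (perm_map link DE).
(* The heights added on peg [i]: one new top height if [i] is [x] or [y], none otherwise; both
   cannot hold since [x < y]. *)
pose new i := [seq (nb_endpoints D i).+1 | _ <- [seq z <- [:: x; y] | z == i]].
have HE i : perm_eq (endpoint_heights (e |` D)%fset i)
                    (new i ++ endpoint_heights D i).
  rewrite (permPl (perm_cat (perm_map _ (perm_filter _ DE))
                            (perm_map _ (perm_filter _ DE)))).
  rewrite /new /= /src /tgt /=.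
  case: eqP => [xi|_] /=; case: eqP => [yi|_] //=.
  - by move: xy; rewrite xi yi ltnn.
  - by rewrite -xi; exact: perm_refl.
  - by rewrite -cat1s perm_catCA yi.
split=> [e'|i h].
  by rewrite !inE => /orP[/eqP ->|/De].
rewrite (perm_mem (HE i)) /nb_endpoints (perm_size (HE i)) size_cat.
rewrite mem_cat Dh /new -/(nb_endpoints D i) /=.
case: eqP => [xi|_] /=; case: eqP => [yi|_] //=.
- by move: xy; rewrite xi yi ltnn.
- by case: h => // h; rewrite inE add1n /= eqSS ltnS [in RHS]leq_eqVlt.
- by case: h => // h; rewrite inE add1n /= eqSS ltnS [in RHS]leq_eqVlt.
Qed.

Lemma web_diagram_exists (L : seq (nat * nat)) :
  {in L, forall p, 0 < p.1 < p.2} ->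
  exists2 D, web_diagram D & perm_eq (links D) L.
Proof.
elim: L => [_|[x y] L IHL pos].
  exists fset0 => //; split=> [e|i h]; first by rewrite inE.
  by rewrite /nb_endpoints /endpoint_heights /=; case: h.
have [D Dw DL] : exists2 D, web_diagram D & perm_eq (links D) L.
  by apply: IHL => p pL; apply: pos; rewrite inE pL orbT.
have [D' D'w D'D] := web_diagram_add Dw (pos (x, y) (mem_head _ _)).
exists D' => //; apply: (perm_trans D'D).
by rewrite perm_cons.
Qed.

(** * Multiplicity vectors over the pairs of pegs *)

Definition peg_pairs (m : nat) : seq (nat * nat) :=
  [seq (i, j) | j <- iota 1 m, i <- iota 1 j.-1].

Lemma mem_peg_pairs m p : (p \in peg_pairs m) = (0 < p.1 < p.2) && (p.2 <= m).
Proof.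
case: p => i j /=; apply/allpairsPdep/idP => [[j' [i' []]]|].
  rewrite !mem_iota !add1n !ltnS => /andP[j0 jm] /andP[i0 ij] [-> ->].
  by rewrite i0 jm -(ltn_predK j0) ltnS ij.
move=> /andP[/andP[i0 ij] jm]; exists j, i; split => //.
  by rewrite mem_iota add1n ltnS jm (leq_trans _ ij).
by rewrite mem_iota add1n i0 (ltn_predK ij).
Qed.

Lemma peg_pairs_uniq m : uniq (peg_pairs m).
Proof.
apply: allpairs_uniq_dep => [|j _|]; rewrite ?iota_uniq //.
by move=> [j i] [j' i'] _ _ /= [-> ->].
Qed.

(** Grouped by the larger peg [j], the pairs number the sum of [j - 1] for [j] from 1 to [m]. *)
Lemma size_peg_pairs m : size (peg_pairs m) = 'C(m, 2).
Proof.
rewrite size_allpairs_dep sumnE big_map -bin2_sum.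
have -> : iota 1 m = index_iota 1 m.+1 by rewrite /index_iota subSS subn0.
by rewrite big_add1; apply: eq_bigr => j _; rewrite size_iota.
Qed.

(** Repeat each element of [P] as often as prescribed; since [P] has no repetition, the copies of
    one element leave the other counts unchanged. *)
Lemma count_mem_realize (T : eqType) (P : seq T) (s : seq nat) :
  uniq P -> size s = size P ->
  exists2 L, {subset L <= P} & [seq count_mem p L | p <- P] = s.
Proof.
elim: P s => [|p P IHP] [|a s] //=; first by exists [::].
move=> /andP[pP UP] [sP]; have [L LP Ls] := IHP s UP sP.
exists (nseq a p ++ L).
  move=> q; rewrite mem_cat mem_nseq inE => /orP[/andP[_ ->] //|/LP ->].
  by rewrite orbT.
rewrite count_cat count_nseq /= eqxx mul1n.
have /count_memPn -> : p \notin L by apply: contra pP => /LP.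
rewrite addn0 -Ls; congr cons; apply/eq_in_map => q qP.
rewrite count_cat count_nseq /=; case: eqP => // pq.
by move: pP; rewrite pq qP.
Qed.

Lemma sumn_count_mem (T : eqType) (P L : seq T) :
  uniq P -> {subset L <= P} -> sumn [seq count_mem p L | p <- P] = size L.
Proof.
move=> UP; elim: L => [|q L IHL] LP.
  by rewrite sumnE big_map big1.
rewrite [size _]/= -IHL; last first.
  by move=> r rL; apply: LP; rewrite inE rL orbT.
rewrite !sumnE !big_map big_split /= -add1n; congr addn.
(* Adding [q] to the list raises exactly one of the counts, because [q] occurs exactly once in
   [P]. *)
have <- : count_mem q P = 1 by rewrite count_uniq_mem // LP ?mem_head.
rewrite -sum1_count [RHS]big_mkcond; apply: eq_bigr => p _.
by rewrite /= eq_sym.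
Qed.

Lemma count_pos_count_mem (T : eqType) (P L : seq T) :
  uniq P -> {subset L <= P} ->
  count (leq 1) [seq count_mem p L | p <- P] = size (undup L).
Proof.
move=> UP LP; rewrite count_map -size_filter; apply: perm_size.
apply: uniq_perm; rewrite ?filter_uniq ?undup_uniq // => q.
rewrite mem_filter mem_undup /= -has_count has_pred1.
by apply/andP/idP => [[]|qL] //; split => //; exact: LP.
Qed.

(* s lists the numbers of edges joining the pairs of pegs, in the order of
   [peg_pairs m]. *)
Definition world (m : nat) (s : seq nat) : set {fset edge} :=
  [set D | [/\ web_diagram D, {subset links D <= peg_pairs m} &
              [seq count_mem p (links D) | p <- peg_pairs m] = s]].

(** With no links outside [peg_pairs m], the counts on these pairs fix the multiset of links, hence
    the web world by [web_world_ofE]. *)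
Lemma worldE m s D : world m s D -> world m s = web_world_of D.
Proof.
move=> [Dw DP Ds]; rewrite web_world_ofE //; apply/seteqP; split=> D'.
  move=> [D'w D'P D's]; split => //; apply/allP => p.
  rewrite mem_cat => pDD'; apply/eqP.
  have /(eq_in_map _ _ _) E : [seq count_mem p (links D') | p <- peg_pairs m] =
            [seq count_mem p (links D) | p <- peg_pairs m] by rewrite Ds.
  by apply: E; case/orP: pDD' => [/D'P|/DP].
move=> [D'w D'D]; split => //.
  by move=> p; rewrite (perm_mem D'D); exact: DP.
by rewrite -Ds; apply/eq_map => p; apply/permP.
Qed.

Lemma world_nonempty m s : size s = 'C(m, 2) -> exists D, world m s D.
Proof.
rewrite -size_peg_pairs => /(count_mem_realize (peg_pairs_uniq m))[L LP Ls].
have [D Dw DL] : exists2 D, web_diagram D & perm_eq (links D) L.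
  by apply: web_diagram_exists => p /LP; rewrite mem_peg_pairs => /andP[].
exists D; split => // [p|]; first by rewrite (perm_mem DL); exact: LP.
by rewrite -Ls; apply/eq_map => p; apply/permP.
Qed.

(** Turns the condition on pegs in [web_worlds] into the condition on links in [world]. *)
Lemma links_peg_pairs D m : web_diagram D ->
  {subset links D <= peg_pairs m} <-> forall i, i \in pegs D -> 1 <= i <= m.
Proof.
move=> [De _]; split=> [DP i|Dm _ /mapP[e eD ->]].
  have ends e : e \in D -> (0 < src e < tgt e) && (tgt e <= m).
    by move=> eD; rewrite -(mem_peg_pairs m (link e)) DP // map_f.
  rewrite in_fsetU => /orP[] /imfsetP[e /= /ends/andP[/andP[e0 lt] em] ->].
    by rewrite e0 (leq_trans (ltnW lt)).
  by rewrite em (leq_trans e0 (ltnW lt)).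
have [e0 lt _ _] := De e eD; rewrite mem_peg_pairs /= e0 lt.
have /Dm/andP[] // : tgt e \in pegs D.
by rewrite in_fsetU; apply/orP; right; apply/imfsetP; exists e.
Qed.

Lemma card_joined_pairs D : #|` joined_pairs D| = size (undup (links D)).
Proof.
apply: perm_size; apply: uniq_perm; rewrite ?fset_uniq ?undup_uniq // => p.
rewrite mem_undup; apply/imfsetP/mapP => -[e eD ->]; by exists e.
Qed.

(** * Counting web worlds by weak compositions *)

(** Enumerates the sequences of [N] naturals with sum [t] and [n] nonzero entries, by first entry
    [j]. The guard excludes [j > 0] with [n = 0], where the truncated [n - (0 < j)] would wrongly be
    0. *)
Fixpoint weak_comps (N t n : nat) : seq (seq nat) :=
  if N is N'.+1 then
    [seq j :: s | j <- iota 0 t.+1,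
                  s <- if (0 < j) <= n
                       then weak_comps N' (t - j) (n - (0 < j)) else [::]]
  else if (t == 0) && (n == 0) then [:: [::]] else [::].

Lemma mem_weak_comps N t n (s : seq nat) :
  (s \in weak_comps N t n) =
  [&& size s == N, sumn s == t & count (leq 1) s == n].
Proof.
elim: N t n s => [|N IHN] t n s.
  case: s => [|a s] /=; last by case: ifP.
  by rewrite (eq_sym 0 t) (eq_sym 0 n); case: ifP.
apply/allpairsPdep/idP => [[j [s' [jt]]]|].
  case: ifP => // jn; rewrite IHN => /and3P[/eqP sN /eqP st /eqP sn] ->.
  move: jt; rewrite mem_iota add0n ltnS /= => jt.
  by rewrite sN st sn !subnKC // !eqxx.
case: s => // j s /and3P[sN /eqP <- /eqP <-].
exists j, s; split => //; first by rewrite mem_iota add0n ltnS /= leq_addr.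
by rewrite leq_addr IHN !addKn !eqxx /= !andbT -eqSS.
Qed.

Lemma weak_comps_uniq N t n : uniq (weak_comps N t n).
Proof.
elim: N t n => [|N IHN] t n; first by rewrite /=; case: ifP.
apply: allpairs_uniq_dep => [|j _|]; first exact: iota_uniq.
  by case: ifP.
by move=> [j s] [j' s'] _ _ /= [-> ->].
Qed.

Lemma size_weak_compsS N t n :
  size (weak_comps N.+1 t n) =
  \sum_(j < t.+1) ((0 < j) <= n) *
    size (weak_comps N (t - j) (n - (0 < j))).
Proof.
rewrite [LHS]size_allpairs_dep sumnE big_map.
rewrite -[iota 0 t.+1]/(index_iota 0 t.+1) big_mkord; apply: eq_bigr => j _.
by case: ifP; rewrite ?mul1n.
Qed.

(** The map [world m] is a bijection from these compositions onto the web worlds counted. *)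
Lemma nww_weak_comps m t n : nww m t n = size (weak_comps 'C(m, 2) t n).
Proof.
have worldP D s : world m s D ->
    (#|` D| = t /\ #|` joined_pairs D| = n) <-> s \in weak_comps 'C(m, 2) t n.
  move=> [_ DP <-]; rewrite mem_weak_comps size_map size_peg_pairs eqxx /=.
  rewrite sumn_count_mem ?count_pos_count_mem ?peg_pairs_uniq //.
  rewrite card_joined_pairs size_map.
  by split=> [[-> ->]|/andP[/eqP -> /eqP ->] //]; rewrite !eqxx.
have E : web_worlds m t n =
    world m @` [set` [fset s in weak_comps 'C(m, 2) t n]%fset].
  apply/seteqP; split=> [W [[D Dw ->] HW]|_ [s /= sC <-]].
    have WD : web_world_of D D by rewrite web_world_ofE.
    have [/(links_peg_pairs _ Dw) DP Dt Dn] := HW D WD.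
    have DS : world m [seq count_mem p (links D) | p <- peg_pairs m] D by [].
    eexists; last exact: (worldE DS).
    by rewrite /= inE; apply/(worldP D).
  rewrite inE in sC.
  have [D Ds] : exists D, world m s D.
    by apply: world_nonempty; move: sC; rewrite mem_weak_comps => /and3P[/eqP].
  split; first by exists D; [case: Ds|exact: worldE].
  move=> D' D's; have [? ?] := (worldP _ _ D's).2 sC; split => //.
  by case: D's => D'w D'P _; apply/links_peg_pairs.
rewrite /nww E fset_set_image ?set_fsetK; last exact: finite_fset.
rewrite card_in_imfset /=; last first.
  (* Injectivity: each world has a diagram, and the link counts of that diagram give back the
     vector. *)
  move=> s s'; rewrite !inE !mem_weak_comps => /and3P[/eqP sN _ _] _ ss'.
  have [D Ds] := world_nonempty sN; have := Ds; rewrite ss'.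
  by case: Ds => _ _ <- [].
by rewrite card_fseq undup_id ?weak_comps_uniq.
Qed.

(** * Coefficients of the generating functions *)

Local Open Scope ring_scope.

(** The factor describes one pair of pegs: [j] edges contribute [z^j], with one [y] exactly when
    [j > 0]. *)
Lemma coef_edge_factor i j k :
  coef (1 + vary * varz / (1 - varz)) i j k =
  ((i == 0%N) && (k == (0 < j))%N)%:R.
Proof.
(* The geometric series, sum of all powers of [z], which is the inverse of [1 - varz]. *)
pose G : fps int := Fps (fun i j k => ((i == 0) && (k == 0))%N%:R).
have GE : (1 - varz) * G = 1.
  rewrite mulrBl mul1r; apply: fpsP => {}i {}j {}k.
  rewrite [LHS]/(_ - coef (fps_mul (monom int 0 1 0) _) i j k) coef_monomM /=.
  rewrite !subn0 -natrM mulnb.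
  by case: i j k => [|i] [|j] [|k].
have -> : (1 - varz)^-1 = G.
  by rewrite -[LHS]mulr1 -[X in _ * X]GE mulKr ?unit_1Bvarz.
rewrite monomM.
rewrite [LHS]/(coef (monom int 0 0 0) i j k +
               coef (fps_mul (monom int 0 1 1) _) i j k) coef_monomM /=.
rewrite !subn0 -natrM mulnb.
by case: i j k => [|i] [|j] [|[|k]].
Qed.

Lemma coef_edge_factorX N i j k :
  coef ((1 + vary * varz / (1 - varz)) ^+ N) i j k =
  ((i == 0) * size (weak_comps N j k))%N%:R.
Proof.
elim: N i j k => [|N IHN] i j k.
  by rewrite expr0 /=; case: i j k => [|i] [|j] [|k].
rewrite exprS.
(* The coefficient of the first factor splits into two Kronecker deltas. They collapse the sums over
   [i1] and [k1]; the second leaves the factor [(0 < j1) <= k], the guard in the recursion of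
   [weak_comps]. *)
transitivity (\sum_(i1 < i.+1) (val i1 == 0%N)%:R *
  (\sum_(j1 < j.+1) \sum_(k1 < k.+1) (val k1 == (0 < j1)%N)%:R *
    ((i - i1 == 0) * size (weak_comps N (j - j1) (k - k1)))%N%:R) : int).
  apply: eq_bigr => i1 _; rewrite mulr_sumr; apply: eq_bigr => j1 _.
  rewrite !mulr_sumr; apply: eq_bigr => k1 _.
  by rewrite IHN coef_edge_factor -mulnb natrM !mulrA.
rewrite (@sum_delta _ i 0 (fun x => \sum_(j1 < j.+1) \sum_(k1 < k.+1)
   (val k1 == (0 < j1)%N)%:R *
    ((i - x == 0) * size (weak_comps N (j - j1) (k - k1)))%N%:R)) mul1r.
rewrite size_weak_compsS big_distrr natr_sum; apply: eq_bigr => j1 _.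
rewrite (@sum_delta _ k (0 < j1)%N (fun x =>
    ((i - 0 == 0) * size (weak_comps N (j - j1) (k - x)))%N%:R)).
by rewrite -natrM subn0 mulnCA.
Qed.

Lemma fsbig_single (R : nmodType) (T : choiceType) (A : set T) (a : T)
    (F : T -> R) :
  (forall x, x <> a -> F x = 0) ->
  \sum_(x \in A) F x = if a \in A then F a else 0.
Proof.
move=> F0; case: ifPn => aA.
  rewrite -[RHS](@fsbig_set1 _ _ +%R _ a F); apply/esym/fsbig_widen.
    by move=> _ ->; exact: set_mem.
  by move=> x [_ xa]; exact: F0.
apply: fsbig1 => x Ax; apply: F0 => xa; move: aA.
by rewrite -xa mem_set.
Qed.

Theorem theorem4p3 :
  fps_sum [set p : nat * nat * nat | (2 <= p.1.1)%N]
    (fun '(m, t, n) =>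
       (nww m t n)%:R * varu ^+ m * varz ^+ t * vary ^+ n) =
  fps_sum [set m : nat | (2 <= m)%N]
    (fun m => (1 + vary * varz / (1 - varz)) ^+ 'C(m, 2) * varu ^+ m).
Proof.
apply: fpsP => i j k.
have termE m t n : coef ((nww m t n)%:R * varu ^+ m * varz ^+ t * vary ^+ n)
    i j k = ([&& i == m, j == t & k == n] * nww m t n)%N%:R.
  rewrite /varu /varz /vary !monomX -!mulrA !monomM.
  rewrite !(muln0, muln1, mul0n, mul1n, addn0, add0n) coef_natM /=.
  by rewrite -natrM mulnC.
have powE m : coef ((1 + vary * varz / (1 - varz)) ^+ 'C(m, 2) * varu ^+ m)
    i j k = ((i == m) * size (weak_comps 'C(m, 2) j k))%N%:R.
  rewrite mulrC /varu monomX [LHS]coef_monomM !(mul0n, mul1n) !subn0 /=.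
  rewrite coef_edge_factorX -natrM andbT mulnA mulnb subn_eq0.
  by rewrite eqn_leq andbC.
(* Only the index [(i, j, k)] on the left and [m = i] on the right reach this coefficient. Both
   sides keep the same test [2 <= i], so they also agree, as 0, when it fails. *)
rewrite [LHS](@fsbig_single _ _ _ (i, j, k)); last first.
  move=> [[m t] n] ne; rewrite termE; case: and3P => // -[/eqP ? /eqP ? /eqP ?].
  by case: ne; congr (_, _, _).
rewrite [RHS](@fsbig_single _ _ _ i); last first.
  by move=> m ne; rewrite powE; case: eqP => // im; case: ne.
by rewrite termE powE !eqxx nww_weak_comps.
Qed.
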